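(* Consider a polymatroid congestion game with finite player set $N$ and finite resource set $E$, in which the strategy space of every player $i\in N$ is the base polytope $P_{\rho_i}$ of a polymatroid $(E,\rho_i)$. If for every player $i\in N$ the polymatroid $(E,\rho_i)$ is a bidirectional flow polymatroid, then the Nash equilibria of the game are unique, i.e. if $\vec x=(\vec x_i)_{i\in N}$ and $\vec y=(\vec y_i)_{i\in N}$ are both Nash equilibria, then $x_{i,e}=y_{i,e}$ for all $i\in N$ and $e\in E$.
   Context: Polymatroids. Let $E$ be a finite set. A function $\rho:2^E\to\mathbb{R}$ is submodular if $\rho(U)+\rho(V)\ge\rho(U\cup V)+\rho(U\cap V)$ for all $U,V\subseteq E$, monotone if $\rho(U)\le\rho(V)$ whenever $U\subseteq V$, and normalized if $\rho(\emptyset)=0$. If $\rho$ is submodular, monotone and normalized, then $(E,\rho)$ is called a polymatroid, and its base polytope is $$P_\rho=\{\vec x\in\mathbb{R}_{\ge0}^E : x(U)\le\rho(U)\ \forall U\subseteq E,\ x(E)=\rho(E)\},\qquad x(U):=\sum_{e\in U}x_e .$$ Bidirectional flow polymatroids. Let $\chi_e\in\mathbb{R}^E$ denote the unit vector of $e\in E$. For $\vec x,\vec y\in P_\rho$, let $D(\vec x,\vec y)$ be the capacitated directed graph with vertex set $E$ in which $(e,e')$ is an edge iff there is $\epsilon>0$ with $\vec x+\epsilon(\chi_{e'}-\chi_e)\in P_\rho$ and $\vec y+\epsilon(\chi_e-\chi_{e'})\in P_\rho$; the capacity of the edge $(e,e')$ is $$\hat c_{\vec x,\vec y}(e,e')=\max\{\alpha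 : \vec x+\alpha(\chi_{e'}-\chi_e)\in P_\rho \text{ and } \vec y+\alpha(\chi_e-\chi_{e'})\in P_\rho\}.$$ A bidirectional flow is a nonnegative flow in $D(\vec x,\vec y)$ respecting these capacities in which every $e$ with $x_e>y_e$ has supply $x_e-y_e$, every $e$ with $x_e<y_e$ has demand $y_e-x_e$, and flow is conserved at all other vertices (that is, outflow minus inflow at each $e\in E$ equals $x_e-y_e$). The polymatroid $(E,\rho)$ is called a bidirectional flow polymatroid if for every $\vec x,\vec y\in P_\rho$ there exists a bidirectional flow in $D(\vec x,\vec y)$. Polymatroid congestion games. There are a finite set $N$ of players and a finite set $E$ of resources. Each player $i$ has a polymatroid $(E,\rho_i)$ and chooses a strategy $\vec x_i=(x_{i,e})_{e\in E}\in P_{\rho_i}$. For a strategy profile $\vec x=(\vec x_i)_{i\in N}$ the total load on $e$ is $x_e=\sum_{i\in N}x_{i,e}$. There are player-specific cost functions $c_{i,e}:\mathbb{R}_{\ge0}\to\mathbb{R}_{\ge0}$, which are non-negative, strictly increasing, differentiable and convex. The cost of player $i$ is $\pi_i(\vec x)=\sum_{e\in E}c_{i,e}(x_e)\,x_{i,e}$. A Nash equilibrium is a strategy profile from which no player can reduce her cost by unilaterally changing her strategy within $P_{\rho_i}$. *)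

(* Defs.v *)
From mathcomp Require Import all_boot all_order all_algebra.
From mathcomp Require Import all_classical all_reals all_analysis.

Set Implicit Arguments.
Unset Strict Implicit.
Unset Printing Implicit Defensive.

Import Order.TTheory GRing.Theory Num.Theory.
Import numFieldNormedType.Exports.

Local Open Scope classical_set_scope.
Local Open Scope ring_scope.

Section Polymatroid.
Context {R : realType} {E : finType}.
Implicit Types (rho : {set E} -> R) (x y : {ffun E -> R}) (U V : {set E}).

Definition submodular rho :=
  forall U V, rho (U :|: V) + rho (U :&: V) <= rho U + rho V.

Definition monotone rho := forall U V, U \subset V -> rho U <= rho V.

Definition normalized rho := rho finset.set0 = 0.

Definition polymatroid rho := [/\ submodular rho, monotone rho & normalized rho].

Definition load x U : R := \sum_(e in U) x e.

Definition base_polytope rho : set {ffun E -> R} :=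
  [set x : {ffun E -> R} |
    [/\ forall e : E, 0 <= x e,
        forall U, load x U <= rho U
      & load x finset.setT = rho finset.setT]].

Definition unit_vec (e : E) : {ffun E -> R} := [ffun g => (g == e)%:R].

(* x + a (chi_e' - chi_e) *)
Definition exchange x (a : R) (e e' : E) : {ffun E -> R} :=
  [ffun g => x g + a * (unit_vec e' g - unit_vec e g)].

(* The amounts that can be moved from e to e' in x and back in y. *)
Definition exchangeable rho x y (e e' : E) : set R :=
  [set a | base_polytope rho (exchange x a e e') /\
           base_polytope rho (exchange y a e' e)].

(* Loops are excluded: they would have unbounded capacity, and flow on them
   never contributes to outflow minus inflow. *)
Definition exchange_edge rho x y (e e' : E) :=
  e != e' /\ exists2 eps, 0 < eps & exchangeable rho x y e e' eps.

(* On an edge this set is nonempty and compact, so its supremum is the maximum. *)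
Definition capacity rho x y (e e' : E) : R := sup (exchangeable rho x y e e').

Definition bidirectional_flow rho x y (f : E -> E -> R) :=
  [/\ forall e e', 0 <= f e e',
      forall e e', exchange_edge rho x y e e' -> f e e' <= capacity rho x y e e',
      forall e e', ~ exchange_edge rho x y e e' -> f e e' = 0
    & forall e : E, \sum_e' f e e' - \sum_e' f e' e = x e - y e].

Definition bidirectional_flow_polymatroid rho :=
  forall x y, base_polytope rho x -> base_polytope rho y ->
    exists f, bidirectional_flow rho x y f.

End Polymatroid.

(* Cost functions live on [0, +oo[; their values at negative arguments are
   irrelevant, and the derivative at 0 is one-sided. *)
Section CostFunction.
Context {R : realType}.
Implicit Type f : R -> R.

Definition nonnegative_on_Rplus f := forall s : R, 0 <= s -> 0 <= f s.

Definition increasing_on_Rplus f :=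
  forall s t : R, 0 <= s -> s < t -> f s < f t.

Definition differentiable_on_Rplus f := forall s : R, 0 <= s ->
  cvg ((f t - f s) / (t - s) @[t --> within `[0, +oo[%classic s^']).

Definition cost_function f :=
  [/\ nonnegative_on_Rplus f, increasing_on_Rplus f,
      differentiable_on_Rplus f
    & @convex_function R R^o (`[0, +oo[%classic : set R) f].

End CostFunction.

Section Game.
Context {R : realType} {N E : finType}.
Implicit Types (rho : N -> {set E} -> R) (c : N -> E -> R -> R).
Implicit Type x : N -> {ffun E -> R}.

Definition total_load x (e : E) : R := \sum_i x i e.

Definition player_cost c (i : N) x : R :=
  \sum_e c i e (total_load x e) * x i e.

Definition strategy_profile rho x := forall i, base_polytope (rho i) (x i).

Definition nash_equilibrium rho c x :=
  strategy_profile rho x /\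
  forall i (z : {ffun E -> R}), base_polytope (rho i) z ->
    player_cost c i x <= player_cost c i [eta x with i |-> z].

End Game.

(* Main.v *)
(* By the first-order conditions at a Nash equilibrium, if player [i] can move
   load from [e] to [e'] in [x_i] and back in [y_i], her marginal costs satisfy
   [mu_e(x) <= mu_e'(x)] and [mu_e'(y) <= mu_e(y)]. Hence
   [d_e = mu_e(x) - mu_e(y)] is nondecreasing along a bidirectional flow, and the
   resources with [d_e > 0] have nonpositive net outflow. This bounds the total
   of [x_{i,e} - y_{i,e}] over the overloaded resources by [0] for every player;
   summing over players, no resource has a larger load in [x] than in [y]. By
   symmetry the loads agree, and the same argument applied to the resources with
   [x_{i,e} > y_{i,e}] gives equality of the strategies. *)
Require Import Defs.
From mathcomp Require Import all_boot all_order all_algebra.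
From mathcomp Require Import all_classical all_reals all_analysis.
From mathcomp Require Import ring lra.

Set Implicit Arguments.
Unset Strict Implicit.
Unset Printing Implicit Defensive.

Import Order.TTheory GRing.Theory Num.Theory.
Import numFieldNormedType.Exports.

Local Open Scope classical_set_scope.
Local Open Scope ring_scope.

(** * One-sided derivatives of convex costs and marginal costs *)

Section MarginalCost.
Context {R : realType}.
Implicit Types (f : R -> R) (s t x k a : R).

Definition Rplus_derive f s : R :=
  lim ((f t - f s) / (t - s) @[t --> within `[0, +oo[%classic s^']).

(** The signed direction [k] lets one right limit in [a] cover both raising and lowering the
    load. *)
Lemma Rplus_derive_cvg_along f s k :
  differentiable_on_Rplus f -> 0 <= s -> k != 0 ->
  (\forall a \near 0^'+, 0 <= s + k * a) ->
  (f (s + k * a) - f s) / (k * a) @[a --> 0^'+] --> Rplus_derive f s.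
Proof.
move=> df s0 k0 pos.
have along : s + k * a @[a --> 0^'+] --> within `[0, +oo[%classic s^'.
  move=> P /= sP.
  have cv : s + k * a @[a --> 0^'+] --> s.
    rewrite -[X in _ --> X]addr0 -[X in _ --> _ + X](mulr0 k).
    apply: cvgD; first exact: cvg_cst.
    apply: cvgM; first exact: cvg_cst.
    by apply: cvg_at_right_filter; exact: cvg_id.
  have {}sP := cv _ sP.
  change (\forall a \near 0^'+, P (s + k * a)).
  near=> a.
  have a0 : 0 < a by near: a; exact: nbhs_right_gt.
  have : s + k * a != s -> s + k * a \in `[0, +oo[ -> P (s + k * a).
    by near: a; exact: sP.
  apply.
    by rewrite -subr_eq0 addrAC subrr add0r mulf_neq0 // gt_eqF.
  by rewrite in_itv /= andbT; near: a.
have slope_cvg : (f t - f s) / (t - s) @[t --> within `[0, +oo[%classic s^']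
    --> Rplus_derive f s := df s s0.
apply: cvg_trans (cvg_comp _ _ along slope_cvg).
by apply: near_eq_cvg; near=> a; rewrite /= [s + _ - s]addrAC subrr add0r.
Unshelve. all: by end_near. Qed.

Lemma convex_Rplus_segment f s t a :
  @convex_function R R^o (`[0, +oo[%classic : set R) f ->
  0 <= s -> 0 <= t -> 0 <= a -> a <= 1 ->
  f (s + (t - s) * a) <= f s + a * (f t - f s).
Proof.
move=> cf s0 t0 a0 a1.
rewrite (_ : s + _ = a * t + (1 - a) * s); last by ring.
rewrite (_ : f s + _ = a * f t + (1 - a) * f s); last by ring.
by apply: (cf (Itv01 a0 a1) t s); rewrite inE /= in_itv /= andbT.
Qed.

Lemma cost_le f s t : cost_function f -> 0 <= s -> s <= t -> f s <= f t.
Proof.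
move=> [_ inc _ _] s0; rewrite le_eqVlt => /predU1P[->//|st].
exact/ltW/inc.
Qed.

(** Convexity bounds the scaled slope on the segment from [s] to [t] by [f t - f s]; then [a] tends
    to [0]. *)
Lemma cost_tangent f s t : cost_function f -> 0 <= s -> 0 <= t ->
  Rplus_derive f s * (t - s) <= f t - f s.
Proof.
move=> [_ _ df cf] s0 t0.
have [->|ts] := eqVneq t s; first by rewrite !subrr mulr0.
have stay a : 0 <= a -> a <= 1 -> 0 <= s + (t - s) * a by nra.
have cv := @Rplus_derive_cvg_along f s (t - s) df s0.
(* The factor [t - s] leaves only [a] in the denominator, so the sign of [t - s] does not matter. *)
have : (f (s + (t - s) * a) - f s) / ((t - s) * a) * (t - s) @[a --> 0^'+]
    --> Rplus_derive f s * (t - s).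
  apply: cvgM; last exact: cvg_cst.
  apply: cv; first by rewrite subr_eq0.
  near=> a; apply: stay; first by near: a; exact: nbhs_right_ge.
  by near: a; apply: nbhs_right_le.
move/cvgr_to_le; apply.
near=> a.
have a0 : 0 < a by near: a; exact: nbhs_right_gt.
have a1 : a <= 1 by near: a; exact: nbhs_right_le.
have := convex_Rplus_segment cf s0 t0 (ltW a0) a1.
rewrite (_ : _ / _ * _ = (f (s + (t - s) * a) - f s) / a); last first.
  by field; rewrite gt_eqF //= subr_eq0.
rewrite ler_pdivrMr //; lra.
Unshelve. all: by end_near. Qed.

(** Add the tangent inequalities at [s] and at [t], then divide by [t - s]. *)
Lemma Rplus_derive_le f s t : cost_function f -> 0 <= s -> s <= t ->
  Rplus_derive f s <= Rplus_derive f t.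
Proof.
move=> cf s0 st; have t0 := le_trans s0 st.
have [->//|ts] := eqVneq s t.
have {ts}st : s < t by rewrite lt_neqAle ts.
have := cost_tangent cf s0 t0; have := cost_tangent cf t0 s0; nra.
Qed.

(** The tangent at [s], evaluated at [0], lies below [f 0 < f s]. *)
Lemma Rplus_derive_gt0 f s : cost_function f -> 0 < s -> 0 < Rplus_derive f s.
Proof.
move=> cf s0; have := cost_tangent cf (ltW s0) (lexx 0).
case: cf => _ inc _ _; have := inc _ _ (lexx 0) s0; nra.
Qed.

Lemma Rplus_derive_ge0 f s : cost_function f -> 0 <= s -> 0 <= Rplus_derive f s.
Proof.
move=> cf s0; case: (cf) => _ inc df _.
have := @Rplus_derive_cvg_along f s 1 df s0 (oner_neq0 _).
have near0 : \forall a \near (0 : R)^'+, 0 <= s + 1 * a.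
  by near=> a; rewrite mul1r addr_ge0 //; near: a; exact: nbhs_right_ge.
move=> /(_ near0)/cvgr_to_ge; apply.
near=> a.
have a0 : 0 < a by near: a; exact: nbhs_right_gt.
rewrite mul1r divr_ge0 ?ltW // subr_gt0; apply: inc => //; lra.
Unshelve. all: by end_near. Qed.

(** The derivative of a player's cost on a resource in her own load [x], when the total load is
    [s]. *)
Definition marginal f s x := f s + x * Rplus_derive f s.

(** Product rule: the quotient equals [k] times the slope of [f] times [x + k * a], plus
    [k * f s]. *)
Lemma marginal_cvg_along f s x k :
  differentiable_on_Rplus f -> 0 <= s -> k != 0 ->
  (\forall a \near 0^'+, 0 <= s + k * a) ->
  (f (s + k * a) * (x + k * a) - f s * x) / a @[a --> 0^'+]
    --> k * marginal f s x.
Proof.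
move=> df s0 k0 pos; have cvd := Rplus_derive_cvg_along df s0 k0 pos.
have cva : k * a @[a --> 0^'+] --> k * 0.
  apply: cvgM; first exact: cvg_cst.
  by apply: cvg_at_right_filter; exact: cvg_id.
have -> : k * marginal f s x =
    k * (Rplus_derive f s * (x + k * 0) + f s) by rewrite /marginal; ring.
have : k * ((f (s + k * a) - f s) / (k * a) * (x + k * a) + f s) @[a --> 0^'+]
    --> k * (Rplus_derive f s * (x + k * 0) + f s).
  apply: cvgM; first exact: cvg_cst.
  apply: cvgD; last exact: cvg_cst.
  apply: cvgM => //.
  by apply: cvgD => //; exact: cvg_cst.
apply: cvg_trans; apply: near_eq_cvg.
near=> a.
have a0 : a != 0 by near: a; exact: nbhs_right_neq.
by field; rewrite a0.
Unshelve. all: by end_near. Qed.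

(* When [t = s], strictness rests on a positive derivative at [s]; this can fail
   at [0], but [0 <= y < x <= s] excludes [s = 0]. *)
Lemma marginal_lt f s t x y : cost_function f ->
  0 <= t -> t <= s -> 0 <= y -> y < x -> x <= s ->
  marginal f t y < marginal f s x.
Proof.
move=> cf t0 ts y0 yx xs; rewrite /marginal.
have s0 : 0 < s by lra.
have ds := Rplus_derive_gt0 cf s0; have dt := Rplus_derive_ge0 cf t0.
have dts := Rplus_derive_le cf t0 ts.
have fts := cost_le cf t0 ts.
nra.
Qed.

Lemma marginal_le f s t x y : cost_function f ->
  0 <= t -> t <= s -> 0 <= y -> y <= x ->
  marginal f t y <= marginal f s x.
Proof.
move=> cf t0 ts y0 yx; rewrite /marginal.
have dt := Rplus_derive_ge0 cf t0.
have dts := Rplus_derive_le cf t0 ts.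
have fts := cost_le cf t0 ts.
nra.
Qed.

End MarginalCost.

(** * Exchanges in the base polytope and flow out of a set *)

Section Flow.
Context {R : realType} {E : finType}.
Implicit Types (rho : {set E} -> R) (x y : {ffun E -> R}) (e : E).

(** The base polytope is convex, and the smaller exchange mixes [x] and the larger one with weight
    [a / eps]. The case [a = 0] is separate because [eps] may then vanish. *)
Lemma exchange_base_polytope rho x e e' (eps a : R) :
  base_polytope rho x -> base_polytope rho (exchange x eps e e') ->
  0 <= a -> a <= eps -> base_polytope rho (exchange x a e e').
Proof.
move=> [x0 xle xT] [z0 zle zT] a0 ale.
have [->|a1] := eqVneq a 0.
  by rewrite (_ : exchange _ _ _ _ = x) //; apply/ffunP => g;
    rewrite !ffunE mul0r addr0.
have eps0 : 0 < eps by rewrite (lt_le_trans _ ale) // lt_neqAle eq_sym a1.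
pose l := a / eps.
have l0 : 0 <= l by rewrite divr_ge0 // ltW.
have l1 : l <= 1 by rewrite ler_pdivrMr // mul1r.
have mix g : exchange x a e e' g = (1 - l) * x g + l * exchange x eps e e' g.
  by rewrite !ffunE /l; field; rewrite gt_eqF.
have mixU U : load (exchange x a e e') U =
    (1 - l) * load x U + l * load (exchange x eps e e') U.
  by rewrite /load !mulr_sumr -big_split; apply: eq_bigr => g _.
split => [g|U|].
- by rewrite mix; have := x0 g; have := z0 g; nra.
- by rewrite mixU; have := xle U; have := zle U; nra.
- by rewrite mixU xT zT; ring.
Qed.

(** Flow inside [S] cancels, which leaves minus the inflow from outside. *)
Lemma net_outflow_le0 (f : E -> E -> R) (S : {set E}) :
  (forall e e', 0 <= f e e') ->
  (forall e e', e \in S -> e' \notin S -> f e e' = 0) ->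
  \sum_(e in S) (\sum_e' f e e' - \sum_e' f e' e) <= 0.
Proof.
move=> f0 closed.
rewrite sumrB subr_le0.
have -> : \sum_(e in S) \sum_e' f e e' = \sum_(e in S) \sum_(e' in S) f e e'.
  apply: eq_bigr => e eS; rewrite (bigID (mem S)) /= [X in _ + X]big1 ?addr0 //.
  by move=> e'; exact: closed.
rewrite exchange_big /=; apply: ler_sum => e eS.
by rewrite [leRHS](bigID (mem S)) /= lerDl sumr_ge0.
Qed.

(* With [d = p - q], the inequalities make [d] nondecreasing along flow, so the
   set [d > 0] has no outgoing flow. Passing from it to [A] only drops nonnegative
   terms of [x - y] and adds nonpositive ones. *)
Lemma bidirectional_flow_sum_le0 rho x y (f : E -> E -> R) (p q : E -> R)
    (A : {set E}) :
  bidirectional_flow rho x y f ->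
  (forall e e', exchange_edge rho x y e e' -> p e <= p e' /\ q e' <= q e) ->
  (forall e, e \in A -> y e < x e -> q e < p e) ->
  (forall e, e \notin A -> x e < y e -> p e <= q e) ->
  \sum_(e in A) (x e - y e) <= 0.
Proof.
move=> [f0 _ fedge fbal] mono inA outA.
pose S := finset (fun e => q e < p e).
apply: (@le_trans _ _ (\sum_(e in S) (x e - y e))); last first.
  under eq_bigr => e _ do rewrite -fbal.
  apply: net_outflow_le0 => // e e'; rewrite !inE => eS e'S.
  apply: fedge => /mono[pe qe].
  by move: e'S; rewrite -leNgt; lra.
rewrite [leLHS]big_mkcond [leRHS]big_mkcond /=; apply: ler_sum => e _.
rewrite inE; have := inA e; have := outA e.
case: (e \in A) => /= out ins; case: ltP => // qp.
- by rewrite leNgt subr_gt0; apply/negP => /(ins isT); rewrite ltNge qp.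
- by rewrite leNgt subr_lt0; apply/negP => /(out isT); rewrite leNgt qp.
Qed.

End Flow.

(** * First-order conditions at equilibrium and comparison of two equilibria *)

Section Uniqueness.
Context {R : realType} {N E : finType}.
Variables (rho : N -> {set E} -> R) (c : N -> E -> R -> R).
Hypothesis c_cost : forall i e, cost_function (c i e).
Implicit Types x y : N -> {ffun E -> R}.

Lemma strategy_le_total_load x i e : strategy_profile rho x ->
  0 <= x i e <= total_load x e.
Proof.
move=> xP; have x0 j : 0 <= x j e by case: (xP j).
by rewrite x0 /total_load (bigD1 i) //= lerDl sumr_ge0.
Qed.

Lemma total_load_with x i (z : {ffun E -> R}) e :
  total_load [eta x with i |-> z] e = total_load x e + (z e - x i e).
Proof.
rewrite /total_load (bigD1 i) //= eqxx [X in _ = X + _](bigD1 i) //=.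
rewrite (eq_bigr (fun j => x j e)); first by ring.
by move=> j /negbTE ->.
Qed.

Lemma player_cost_exchange x i e e' (a : R) : e != e' ->
  let X := total_load x in
  player_cost c i [eta x with i |-> exchange (x i) a e e'] - player_cost c i x =
  (c i e (X e - a) * (x i e - a) - c i e (X e) * x i e) +
  (c i e' (X e' + a) * (x i e' + a) - c i e' (X e') * x i e').
Proof.
move=> ee' X; rewrite /player_cost -sumrB (bigD1 e) //= (bigD1 e') 1?eq_sym //=.
rewrite big1 ?addr0.
  rewrite !total_load_with /= !eqxx !ffunE !eqxx (negbTE ee').
  rewrite [e' == e]eq_sym (negbTE ee') /X sub0r subr0 mulr1 mulrN1.
  by congr (c _ _ _ * _ - _ + (c _ _ _ * _ - _)); ring.
move=> g /andP[/negbTE ge /negbTE ge'].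
by rewrite total_load_with /= !eqxx !ffunE ge ge' subrr mulr0 addr0 subrr addr0 subrr.
Qed.

(** Moving a small [a] from [e] to [e'] is feasible and cannot lower the cost; divide the change by
    [a] and let [a] tend to [0]. *)
Lemma nash_marginal_le x i e e' (eps : R) : nash_equilibrium rho c x ->
  e != e' -> 0 < eps -> base_polytope (rho i) (exchange (x i) eps e e') ->
  marginal (c i e) (total_load x e) (x i e) <=
  marginal (c i e') (total_load x e') (x i e').
Proof.
move=> [xP xN] ee' eps0 zP.
have /andP[xe0 xe] := strategy_le_total_load i e xP.
have /andP[xe'0 xe'] := strategy_le_total_load i e' xP.
(* Nonnegativity of the exchanged strategy at [e]; it keeps the load on [e] nonnegative for all
   [a <= eps]. *)
have epsx : eps <= x i e.
  by case: zP => /(_ e); rewrite !ffunE eqxx (negbTE ee') sub0r mulrN1 subr_ge0.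
have [_ _ de _] := c_cost i e; have [_ _ de' _] := c_cost i e'.
have n1 : (-1 : R) != 0 by rewrite oppr_eq0 oner_eq0.
have He := @marginal_cvg_along R (c i e) (total_load x e) (x i e) (-1) de.
have He' := @marginal_cvg_along R (c i e') (total_load x e') (x i e') 1 de'.
have {}He := He (le_trans xe0 xe) n1.
have {}He' := He' (le_trans xe'0 xe') (oner_neq0 _).
have ne : \forall a \near (0 : R)^'+, 0 <= total_load x e + -1 * a.
  near=> a; rewrite mulN1r subr_ge0; apply: le_trans xe; apply: le_trans epsx.
  by near: a; exact: nbhs_right_le.
have ne' : \forall a \near (0 : R)^'+, 0 <= total_load x e' + 1 * a.
  near=> a; rewrite mul1r; apply: addr_ge0; first exact: le_trans xe'0 xe'.
  by near: a; exact: nbhs_right_ge.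
rewrite -subr_ge0 addrC -[- _]mulN1r -[X in _ + X]mul1r.
apply: (cvgr_to_ge (cvgD (He ne) (He' ne'))).
near=> a.
have a0 : 0 < a by near: a; exact: nbhs_right_gt.
have ae : a <= eps by near: a; exact: nbhs_right_le.
have := xN i _ (exchange_base_polytope (xP i) zP (ltW a0) ae).
rewrite -subr_ge0 player_cost_exchange //= => D.
by rewrite fctE /= -mulrDl mulN1r mul1r divr_ge0 // ltW.
Unshelve. all: by end_near. Qed.

(** The conditions on [A] fit both later choices: the overloaded resources, and those where player
    [i] uses more in [x] than in [y]. *)
Lemma nash_flow_sum_le0 x y i (A : {set E}) :
  bidirectional_flow_polymatroid (rho i) ->
  nash_equilibrium rho c x -> nash_equilibrium rho c y ->
  (forall e, e \in A -> total_load y e <= total_load x e) ->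
  (forall e, e \notin A -> x i e < y i e -> total_load x e <= total_load y e) ->
  \sum_(e in A) (x i e - y i e) <= 0.
Proof.
move=> bif xN yN inA outA; have [[xP _] [yP _]] := (xN, yN).
have [f flow] := bif _ _ (xP i) (yP i).
apply: (bidirectional_flow_sum_le0
  (p := fun e => marginal (c i e) (total_load x e) (x i e))
  (q := fun e => marginal (c i e) (total_load y e) (y i e)) flow).
- move=> e e' [ee' [eps eps0 [xz yz]]]; split.
    exact: (nash_marginal_le xN ee' eps0 xz).
  by apply: (nash_marginal_le yN _ eps0 yz); rewrite eq_sym.
- move=> e eA yx.
  have /andP[? ?] := strategy_le_total_load i e xP.
  have /andP[? ?] := strategy_le_total_load i e yP.
  apply: marginal_lt => //; [lra|exact: inA].
- move=> e eA xy.
  have /andP[? ?] := strategy_le_total_load i e xP.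
  have /andP[? ?] := strategy_le_total_load i e yP.
  apply: marginal_le => //; [lra|exact: outA|lra].
Qed.

Hypothesis rho_bidirectional : forall i, bidirectional_flow_polymatroid (rho i).

Lemma nash_total_load_le x y e :
  nash_equilibrium rho c x -> nash_equilibrium rho c y ->
  total_load x e <= total_load y e.
Proof.
move=> xN yN; rewrite leNgt; apply/negP => yx.
pose A := finset (fun g => total_load y g < total_load x g).
have : \sum_(g in A) (total_load x g - total_load y g) <= 0.
  (* [A] depends only on total loads, so the sum splits into one bound per player. *)
  under eq_bigr do rewrite -sumrB.
  rewrite exchange_big sumr_le0 // => i _.
  apply: nash_flow_sum_le0 => // g; rewrite inE; first exact: ltW.
  by rewrite -leNgt.
apply/negP; rewrite -ltNge (bigD1 e) ?inE //= ltr_wpDr ?subr_gt0 //.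
by apply: sumr_ge0 => g /andP[]; rewrite inE => /ltW; rewrite subr_ge0.
Qed.

Lemma nash_strategy_le x y i e :
  nash_equilibrium rho c x -> nash_equilibrium rho c y -> x i e <= y i e.
Proof.
move=> xN yN; rewrite leNgt; apply/negP => yx.
pose A := finset (fun g => y i g < x i g).
have : \sum_(g in A) (x i g - y i g) <= 0.
  (* Both load conditions hold for any set, since total loads compare in both directions. *)
  by apply: nash_flow_sum_le0 => // g _ *; exact: nash_total_load_le.
apply/negP; rewrite -ltNge (bigD1 e) ?inE //= ltr_wpDr ?subr_gt0 //.
by apply: sumr_ge0 => g /andP[]; rewrite inE => /ltW; rewrite subr_ge0.
Qed.

End Uniqueness.

Theorem theorem4p2 (R : realType) (N E : finType)
    (rho : N -> {set E} -> R) (c : N -> E -> R -> R)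
    (rho_polymatroid : forall i, polymatroid (rho i))
    (c_cost : forall i e, cost_function (c i e))
    (rho_bidirectional : forall i, bidirectional_flow_polymatroid (rho i))
    (x y : N -> {ffun E -> R})
    (x_nash : nash_equilibrium rho c x)
    (y_nash : nash_equilibrium rho c y) :
  forall (i : N) (e : E), x i e = y i e.
Proof.
by move=> i e; apply/eqP; rewrite eq_le !(nash_strategy_le c_cost rho_bidirectional).
Qed.
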